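(* Let $n\ge 2$, let $p(z)=\prod_{j=1}^{n}(z-z_j)$ be a complex polynomial of degree $n$ with zeros $z_1,z_2,\ldots,z_n\in\mathbb{C}$, and let $w_1,w_2,\ldots,w_{n-1}$ be its critical points. Assume that $\sum_{j=1}^n z_j=0$. Then $$\sum_{k=1}^{n-1}|w_k|^6\le \frac{n-6}{n}\sum_{j=1}^n|z_j|^6+\frac{6}{n^2}\left(\sum_{j=1}^n|z_j|^4\right)\left(\sum_{j=1}^n|z_j|^2\right)+\frac{3}{n^2}\left|\sum_{j=1}^n z_j|z_j|^2\right|^2-\frac{2}{n^3}\left(\sum_{j=1}^n|z_j|^2\right)^3,$$ with equality if and only if all $z_j$ lie on a straight line in the complex plane.
   Context: The critical points of a polynomial $p(z)$ of degree $n$ are the $n-1$ zeros of its derivative $p'(z)$. Zeros and critical points are listed with multiplicity. *)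

(* Defs.v *)
From HB Require Import structures.
From mathcomp Require Import all_boot all_order all_algebra.
From mathcomp Require Import reals.
From mathcomp Require Import complex.

Set Implicit Arguments.
Unset Strict Implicit.
Unset Printing Implicit Defensive.

Import Order.TTheory GRing.Theory Num.Theory.
Local Open Scope ring_scope.

(* [s] lists the zeros of [p] with multiplicity. For [p = 0] this holds of
   every [s]; it is only meant for nonzero [p]. *)
Definition lists_zeros (F : closedFieldType) (m : nat)
    (p : {poly F}) (s : 'I_m -> F) : Prop :=
  p = lead_coef p *: \prod_(k < m) ('X - (s k)%:P).

Definition lists_critical_points (F : closedFieldType) (m : nat)
    (p : {poly F}) (w : 'I_m -> F) : Prop :=
  lists_zeros p^`() w.

Definition on_straight_line (R : realType) (m : nat) (z : 'I_m -> R[i]) : Prop :=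
  exists a b : R[i], b != 0 /\ forall j, exists t : R, z j = a + t%:C%C * b.

(* Main.v *)
Require Import Defs.
From HB Require Import structures.
From mathcomp Require Import all_boot all_order all_algebra.
From mathcomp Require Import reals.
From mathcomp Require Import complex.
From mathcomp Require Import spectral ring.

Set Implicit Arguments.
Unset Strict Implicit.
Unset Printing Implicit Defensive.

Import Order.TTheory GRing.Theory Num.Theory.
Local Open Scope ring_scope.
Local Open Scope sesquilinear_scope.

(** The critical points are the eigenvalues of a matrix built from the zeros,
    and the inequality is Weyl's inequality between eigenvalues and singular
    values of that matrix, for the exponent 6.

    Let D be the diagonal matrix of the zeros, P = I - J/n the orthogonal
    projection onto the vectors of sum zero (J has all entries 1), and
    A = P D P.  By the determinant formula for rank one perturbations,
    n * det(X - A) = X * p' ([char_poly_differentiator]), so the eigenvalues of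
    A are 0 and the w_k.

    For any A, the sum of the |eigenvalue|^6 is at most the trace of (A^* A)^3,
    with equality exactly when A is normal ([sum_norm6_eigen_le_trace]).
    Schur's triangularization reduces this to a triangular matrix T; with
    M = T^* T one has |T_ii|^2 <= M_ii and M_ii^3 <= (M^3)_ii, and equality
    throughout makes every column of T vanish off the diagonal.

    It remains to read both sides off the zeros, assuming that their sum is 0.
    The trace of (A^* A)^3 is that of (P K)^3 for K = D^* P D.  Here P K is a
    rank one perturbation of K, and K of the diagonal matrix D^* D; expanding
    twice gives exactly the right-hand side
    ([trace_gram_differentiator_cube]).  Similarly
    A^* A and A A^* differ only by rank one terms, so that A is normal exactly
    when every z_i * conj(z_j) is real ([differentiator_normalP]); this says
    that the zeros lie on a line through their centroid 0
    ([on_straight_line_sum0P]). *)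

(** * Characteristic polynomials and rank one perturbations *)

(** Sylvester's identity: both sides are the determinant of the block matrix
    with rows (1, -A) and (B, 1), eliminated along either diagonal block. *)
Lemma det_add1_mulC (R : comNzRingType) (m n : nat)
    (A : 'M[R]_(m, n)) (B : 'M[R]_(n, m)) :
  \det (1%:M + A *m B) = \det (1%:M + B *m A).
Proof.
have eL : block_mx 1%:M (- A) B 1%:M
    = block_mx (1%:M + A *m B) (- A) 0 1%:M *m block_mx 1%:M 0 B 1%:M.
  by rewrite mulmx_block !(mulmx1, mul1mx, mulmx0, mul0mx) mulNmx addrK !add0r.
have eR : block_mx 1%:M (- A) B 1%:M
    = block_mx 1%:M 0 B 1%:M *m block_mx 1%:M (- A) 0 (1%:M + B *m A).
  rewrite mulmx_block !(mulmx1, mul1mx, mulmx0, mul0mx) mulmxN !addr0.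
  by rewrite [_ + B *m A]addrC addKr.
have := congr1 determinant eL; rewrite eR !det_mulmx.
by rewrite !det_lblock !det_ublock !det1 !mul1r !mulr1.
Qed.

(** The same double elimination, now of the block matrix with rows (X, A) and
    (B, 1).  Clearing B without dividing by X costs a factor X^n on both sides,
    which is cancelled at the end. *)
Lemma char_poly_mulC (R : idomainType) (n : nat) (A B : 'M[R]_n) :
  char_poly (A *m B) = char_poly (B *m A).
Proof.
pose a := map_mx (@polyC R) A; pose b := map_mx (@polyC R) B.
have Xn0 : ('X ^+ n : {poly R}) != 0 by rewrite monic_neq0 ?monicXn.
apply: (mulfI Xn0).
have e1 : block_mx 'X%:M a b 1%:M
    = block_mx ('X%:M - a *m b) a 0 1%:M *m block_mx 1%:M 0 b 1%:M.
  by rewrite mulmx_block !(mulmx1, mul1mx, mulmx0, mul0mx) subrK !add0r.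
have e2 : block_mx 1%:M 0 (- b) 'X%:M *m block_mx 'X%:M a b 1%:M
    = block_mx 'X%:M a 0 ('X%:M - b *m a).
  rewrite mulmx_block !(mulmx1, mul1mx, mulmx0, mul0mx) !addr0 !mulNmx.
  by rewrite addrC [- _ + _]addrC scalar_mxC subrr.
have := congr1 determinant e2; rewrite e1 !det_mulmx.
rewrite !det_lblock !det_ublock !det1 !det_scalar !mul1r !mulr1.
by rewrite /char_poly /char_poly_mx !map_mxM.
Qed.

(** Each occurrence of the rank one matrix c r cuts the cyclic word under the
    trace, so the terms are products of the numbers r K^i c. *)
Lemma mxtrace_cube_sub_rank1 (R : comNzRingType) (n : nat)
    (K : 'M[R]_n) (c : 'cV[R]_n) (r : 'rV[R]_n) :
  \tr ((K - c *m r) *m (K - c *m r) *m (K - c *m r))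
  = \tr (K *m K *m K) - 3 * \tr (r *m (K *m K) *m c)
    + 3 * (\tr (r *m c) * \tr (r *m K *m c)) - \tr (r *m c) ^+ 3.
Proof.
have scal (u : 'M[R]_1) : u = (\tr u)%:M by rewrite trace_mx11 -mx11_scalar.
have C1 X : \tr (X *m (c *m r)) = \tr (r *m X *m c).
  by rewrite mulmxA mxtrace_mulC mulmxA.
have eq2 : (c *m r) *m (c *m r) = \tr (r *m c) *: (c *m r).
  by rewrite mulmxA -[c *m r *m c]mulmxA [r *m c]scal mul_mx_scalar -scalemxAl -scal.
have eq3 : (c *m r) *m K *m (c *m r) = \tr (r *m K *m c) *: (c *m r).
  rewrite !mulmxA -[c *m r *m K]mulmxA -[_ *m c]mulmxA [r *m K *m c]scal.
  by rewrite mul_mx_scalar -scalemxAl -scal.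
set E := c *m r in C1 eq2 eq3 *.
have E1 : \tr (K *m E) = \tr (r *m K *m c) by rewrite C1.
have E2 : \tr (K *m K *m E) = \tr (r *m (K *m K) *m c) by rewrite C1.
have E0 : \tr E = \tr (r *m c) by rewrite mxtrace_mulC.
clearbody E.
rewrite !(mulmxBl, mulmxBr) !mulmxA.
rewrite -[K *m E *m E]mulmxA eq2 eq3 -!scalemxAl -!scalemxAr eq2.
rewrite !linearB /= !linearZ /= E0.
rewrite [\tr (E *m K *m K)]mxtrace_mulC !mulmxA.
rewrite [\tr (K *m E *m K)]mxtrace_mulC [\tr (E *m K)]mxtrace_mulC !mulmxA.
rewrite E1 E2 !mulmxA.
ring.
Qed.

(** * Weyl's inequality for sixth powers *)

Section Weyl.
Variable C : numClosedFieldType.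

Lemma gram_diagE (m n : nat) (B : 'M[C]_(m, n)) (i : 'I_n) :
  (B^t* *m B) i i = \sum_k `|B k i| ^+ 2.
Proof. by rewrite mxE; apply: eq_bigr => k _; rewrite !mxE normCKC. Qed.

Lemma gram_diag_ge (n : nat) (T : 'M[C]_n) i :
  `|T i i| ^+ 2 <= (T^t* *m T) i i.
Proof.
rewrite gram_diagE (bigD1 i) //= lerDl.
by apply: sumr_ge0 => k _; rewrite exprn_ge0.
Qed.

Lemma gram_herm (m n : nat) (T : 'M[C]_(m, n)) : (T^t* *m T)^t* = T^t* *m T.
Proof. by rewrite trmx_mul map_mxM trmxCK. Qed.

(** For a positive semidefinite M and c = M_ii, the i-th diagonal entry of
    (M - c) M (M - c) is nonnegative, so (M^3)_ii >= 2 c (M^2)_ii - c^3, and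
    (M^2)_ii >= c^2.  This replaces Jensen's inequality for the spectral measure
    of M at the i-th basis vector. *)
Lemma gram_cube_diag_ge (n : nat) (T : 'M[C]_n) (M := T^t* *m T) i :
  M i i ^+ 3 <= (M *m M *m M) i i.
Proof.
have MH : M^t* = M by exact: gram_herm.
have cge0 : 0 <= M i i.
  by rewrite /M gram_diagE sumr_ge0 // => k _; rewrite exprn_ge0.
set c := M i i in cge0 *.
have cR : (c%:M : 'M[C]_n)^t* = c%:M.
  by rewrite tr_scalar_mx map_scalar_mx /= geC0_conj.
have M2 : c ^+ 2 <= (M *m M) i i.
  rewrite -{1}MH; apply: le_trans (gram_diag_ge M i).
  by rewrite ger0_norm.
have hM : T^t* *m T = M by [].
clearbody M.
have eG : (T *m (M - c%:M))^t* *m (T *m (M - c%:M))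
    = M *m M *m M - (2 * c) *: (M *m M) + c ^+ 2 *: M.
  rewrite trmx_mul map_mxM linearB /= map_mxB MH cR !mulmxA.
  rewrite -[_ *m T^t* *m T]mulmxA hM mulmxBl mul_scalar_mx mulmxBr mul_mx_scalar mulmxBl.
  rewrite -scalemxAl scalerBr scalerA -expr2 mulr_natl mulr2n scalerDl !opprD opprK.
  by rewrite !addrA.
have := gram_diagE (T *m (M - c%:M)) i; rewrite {}eG => eG.
have ge0 : 0 <= (M *m M *m M) i i - 2 * c * (M *m M) i i + c ^+ 3.
  have -> : (M *m M *m M) i i - 2 * c * (M *m M) i i + c ^+ 3
      = (M *m M *m M - (2 * c) *: (M *m M) + c ^+ 2 *: M) i i.
    by rewrite [c ^+ 3]exprSr !mxE.
  by rewrite eG sumr_ge0 // => k _; rewrite exprn_ge0.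
rewrite -subr_ge0.
have -> : (M *m M *m M) i i - c ^+ 3
    = ((M *m M *m M) i i - 2 * c * (M *m M) i i + c ^+ 3)
      + 2 * c * ((M *m M) i i - c ^+ 2) by ring.
by rewrite addr_ge0 // mulr_ge0 ?mulr_ge0 // subr_ge0.
Qed.

(** The bound compares diagonal entries one by one:
    |T_ii|^6 <= M_ii^3 <= (M^3)_ii.  Equality in the first step for every i
    forces T to be diagonal, because M_ii is the squared norm of its i-th
    column. *)
Lemma sum_norm6_diag_le_trace (n : nat) (T : 'M[C]_n) (M := T^t* *m T) :
  \sum_i `|T i i| ^+ 6 <= \tr (M *m M *m M) ?= iff is_diag_mx T.
Proof.
have norm6 i : `|T i i| ^+ 6 = (`|T i i| ^+ 2) ^+ 3 by rewrite -exprM.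
have M_ge0 i : 0 <= M i i by apply: le_trans (gram_diag_ge T i); rewrite exprn_ge0.
have le1 i : `|T i i| ^+ 6 <= M i i ^+ 3.
  by rewrite norm6 lerXn2r ?nnegrE ?exprn_ge0 // gram_diag_ge.
have le2 i : `|T i i| ^+ 6 <= (M *m M *m M) i i.
  by apply: le_trans (le1 i) _; exact: gram_cube_diag_ge.
split; first exact: ler_sum.
(* The sums can only agree termwise, which squeezes M_ii to |T_ii|^2. *)
apply/eqP/idP => [eqS | /is_diag_mxP dT].
  have d0 i : (M *m M *m M) i i = `|T i i| ^+ 6.
    apply/eqP; rewrite -subr_eq0; apply/eqP.
    apply: (@psumr_eq0P _ _ xpredT (fun i => (M *m M *m M) i i - `|T i i| ^+ 6)) => //.
      by move=> j _; rewrite subr_ge0.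
    by rewrite sumrB eqS; exact: subrr.
  apply/is_diag_mxP => k i neq.
  have eqM : M i i = `|T i i| ^+ 2.
    apply/le_anti/andP; split; last exact: gram_diag_ge.
    rewrite -(@ler_pXn2r _ 3) ?nnegrE ?exprn_ge0 // -norm6 -d0.
    exact: gram_cube_diag_ge.
  move: eqM; rewrite /M gram_diagE (bigD1 i) //= => /(canRL (addKr _)).
  rewrite addNr => s0; apply/eqP; rewrite -normr_eq0 -sqrf_eq0; apply/eqP.
  by apply: (psumr_eq0P _ s0) => // j _; exact: exprn_ge0.
have dM i j : M i j = (`|T i i| ^+ 2) *+ (i == j).
  rewrite /M mxE (bigD1 i) //= !mxE big1 ?addr0 => [|k ki].
    case: (eqVneq i j) => [<-|ij]; first by rewrite normCKC mulr1n.
    by rewrite [T i j]dT /= ?mulr0 ?mulr0n.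
  by rewrite !mxE [T k i]dT // conjC0 mul0r.
have -> : M = diag_mx (\row_i (`|T i i| ^+ 2)).
  by apply/matrixP=> i j; rewrite dM !mxE.
rewrite !mulmx_diag mxtrace_diag; apply: eq_bigr => i _.
by rewrite !mxE norm6 exprSr expr2.
Qed.

Lemma char_poly_unitary_conj (n : nat) (U T : 'M[C]_n) :
  U \is unitarymx -> char_poly (U^t* *m T *m U) = char_poly T.
Proof.
by move=> /unitarymxP hU; rewrite char_poly_mulC mulmxA hU mul1mx.
Qed.

(** A unitary change of basis alters neither the eigenvalues nor the trace, and
    the eigenvalues of a triangular matrix are its diagonal entries. *)
Lemma sum_norm6_eigen_unitary (n : nat) (U T : 'M[C]_n) (s : seq C)
    (A := U^t* *m T *m U) (M := A^t* *m A) :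
  U \is unitarymx -> is_trig_mx T -> char_poly A = \prod_(x <- s) ('X - x%:P) ->
  \sum_(x <- s) `|x| ^+ 6 <= \tr (M *m M *m M) ?= iff is_diag_mx T.
Proof.
move=> hU trT; rewrite char_poly_unitary_conj // char_poly_trig // => es.
have pe : perm_eq s [seq T i i | i <- index_enum 'I_n].
  by apply: prod_XsubC_eq; rewrite -es big_map.
rewrite (perm_big _ pe) big_map.
have -> : \tr (M *m M *m M) = \tr ((T^t* *m T) *m (T^t* *m T) *m (T^t* *m T)).
  have -> : M = U^t* *m (T^t* *m T) *m U.
    rewrite /M /A !trmx_mul !map_mxM trmxCK !mulmxA.
    by rewrite (mulmxtVK _ hU).
  rewrite !mulmxA (mulmxtVK _ hU) (mulmxtVK _ hU).
  by rewrite mxtrace_mulC !mulmxA (unitarymxP hU) mul1mx.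
exact: sum_norm6_diag_le_trace.
Qed.

(** Weyl's inequality.  For normal A a unitary diagonalization gives equality;
    otherwise no Schur triangular form of A is diagonal, which makes the
    inequality strict. *)
Lemma sum_norm6_eigen_le_trace (n : nat) (A : 'M[C]_n) (s : seq C)
    (M := A^t* *m A) :
  char_poly A = \prod_(x <- s) ('X - x%:P) ->
  \sum_(x <- s) `|x| ^+ 6 <= \tr (M *m M *m M) ?= iff (A \is normalmx).
Proof.
move=> es.
have [nA | nA] := boolP (A \is normalmx).
  have /orthomx_spectral_subproof [[U d] /= hU eA] := nA.
  rewrite invmx_unitary // in eA; rewrite /M; move: es; rewrite eA => es.
  have := sum_norm6_eigen_unitary hU (diag_mx_is_trig d) es.
  by rewrite diag_mx_is_diag.
case: (posnP n) => [n0|n_gt0].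
  case/negP: nA; apply/normalmxP/matrixP => i.
  by have := ltn_ord i; rewrite [X in (_ < X)%N]n0.
have [U hU trT] := Schur A n_gt0.
have eA : A = U^t* *m conjmx U A *m U.
  by rewrite conjymx // !mulmxA mulmxKtV // (mulmx1C (unitarymxP hU)) mul1mx.
rewrite /M; move: es; rewrite {1}eA => es.
have := sum_norm6_eigen_unitary hU trT es; rewrite -eA.
suff -> : is_diag_mx (conjmx U A) = false by [].
apply: contraNF nA => /diag_mxP [d Td]; rewrite eA Td.
apply/orthomx_spectral_subproof; exists (U, d) => //=.
by rewrite invmx_unitary.
Qed.
End Weyl.

(** * The differentiator of a tuple of zeros *)

Lemma horner_deriv_prod_XsubC (F : fieldType) (I : Type) (r : seq I)
    (z : I -> F) (x : F) :
  (forall j, x != z j) ->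
  (\prod_(j <- r) ('X - (z j)%:P))^`().[x]
  = (\prod_(j <- r) (x - z j)) * \sum_(j <- r) (x - z j)^-1.
Proof.
move=> xz; elim: r => [|j r IH]; first by rewrite !big_nil derivC horner0 mulr0.
have ne0 : x - z j != 0 by rewrite subr_eq0.
rewrite !big_cons derivM derivXsubC mul1r hornerD hornerM IH hornerXsubC.
rewrite horner_prod (eq_bigr (fun j => x - z j)) => [|k _]; last exact: hornerXsubC.
by field.
Qed.

Lemma mul_row_diag (R : nzRingType) (n : nat) (f g : 'I_n -> R) :
  (\row_j f j) *m diag_mx (\row_j g j) = \row_j (f j * g j).
Proof. by apply/rowP=> j; rewrite mul_mx_diag !mxE. Qed.

Lemma mul_diag_col (R : nzRingType) (n : nat) (f g : 'I_n -> R) :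
  diag_mx (\row_j f j) *m (\col_j g j) = \col_j (f j * g j).
Proof. by apply/colP=> j; rewrite mul_diag_mx !mxE. Qed.

Lemma mxtrace_row_col (R : comNzRingType) (n : nat) (f g : 'I_n -> R) :
  \tr ((\row_j f j) *m (\col_j g j)) = \sum_j f j * g j.
Proof. by rewrite trace_mx11 mxE; apply: eq_bigr => j _; rewrite !mxE. Qed.

Section Differentiator.
Variable C : numClosedFieldType.

(** The projection I - J/n, with J/n written as column times row so that the
    rank one lemmas apply to it. *)
Definition centering n : 'M[C]_n := 1%:M - (\col__ 1) *m (\row__ n%:R^-1).

Definition differentiator n (z : 'I_n -> C) : 'M[C]_n :=
  centering n *m diag_mx (\row_j z j) *m centering n.

Lemma centering_idem n : centering n *m centering n = centering n.
Proof.
have [->|n0] := posnP n; first by apply/matrixP => -[].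
have rc : (\row_(_ < n) n%:R^-1) *m (\col__ 1) = 1%:M :> 'M[C]_1.
  rewrite [LHS]mx11_scalar -trace_mx11 mxtrace_row_col.
  by rewrite sumr_const card_ord -[_ *+ n]mulr_natr mulr1 mulVf // pnatr_eq0 -lt0n.
rewrite {1}/centering mulmxBl mul1mx -mulmxA.
have -> : (\row__ n%:R^-1) *m centering n = 0.
  by rewrite mulmxBr mulmx1 mulmxA rc mul1mx subrr.
by rewrite mulmx0 subr0.
Qed.

Lemma centering_adj n : (centering n)^t* = centering n.
Proof.
apply/matrixP => i j; rewrite !mxE !big_ord1 !mxE !mul1r eq_sym.
by rewrite rmorphB /= rmorph_nat fmorphV rmorph_nat.
Qed.

Lemma differentiator_adj n (z : 'I_n -> C) :
  (differentiator z)^t* = differentiator (fun j => (z j)^*).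
Proof.
rewrite /differentiator !trmx_mul !map_mxM centering_adj mulmxA.
congr (_ *m _ *m _); rewrite tr_diag_mx map_diag_mx; congr diag_mx.
by apply/rowP => j; rewrite !mxE.
Qed.

(** Moving both projections to the right of D turns A into D P, whose
    X - D P = (X - D) + (D 1)(1^T/n) is a rank one perturbation of a diagonal
    matrix.  Where x is not a zero, its determinant is p(x) times
    1 + (1/n) sum_j z_j/(x - z_j) = (x/n) sum_j 1/(x - z_j), that is x p'(x)/n;
    polynomials that agree off the finitely many zeros are equal. *)
Lemma char_poly_differentiator n (z : 'I_n -> C) : (0 < n)%N ->
  n%:R *: char_poly (differentiator z)
  = 'X * (\prod_(j < n) ('X - (z j)%:P))^`().
Proof.
move=> n0; set p := \prod_(j < n) _.
have nn0 : n%:R != 0 :> C by rewrite pnatr_eq0 -lt0n.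
rewrite /differentiator -mulmxA char_poly_mulC -mulmxA centering_idem.
(* Multiplying the difference by p reduces to points that are not zeros of p. *)
apply/eqP; rewrite -subr_eq0; set q := _ - _.
have p0 : p != 0 by rewrite monic_neq0 // monic_prod_XsubC.
suff : q * p == 0 by rewrite mulf_eq0 (negPf p0) orbF.
apply/negPn/negP => /closed_nonrootP [x]; rewrite rootM negb_or => /andP [qx px].
have xz j : x != z j.
  apply: contraNneq px => ->; rewrite rootE horner_prod (bigD1 j) //=.
  by rewrite hornerXsubC subrr mul0r.
have xz0 j : x - z j != 0 by rewrite subr_eq0.
case/negP: qx; rewrite rootE !hornerE horner_deriv_prod_XsubC // subr_eq0.
rewrite -horner_evalE -det_map_mx.
have -> : map_mx (horner_eval x) (char_poly_mx (diag_mx (\row_j z j) *m centering n))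
   = diag_mx (\row_j (x - z j)) *m
      (1%:M + (\col_j ((x - z j)^-1 * z j)) *m (\row__ n%:R^-1)).
  have -> : \col_j ((x - z j)^-1 * z j) =
     diag_mx (\row_j (x - z j)^-1) *m (diag_mx (\row_j z j) *m (\col__ 1)) :> 'cV_n.
     by rewrite !mul_diag_col; apply/colP => j; rewrite !mxE mulr1.
  have YV : diag_mx (\row_j (x - z j)) *m diag_mx (\row_j (x - z j)^-1) = 1%:M.
    by rewrite mulmx_diag; apply/matrixP => i j; rewrite !mxE mulfV.
  rewrite [RHS]mulmxDr mulmx1 !mulmxA YV mul1mx /centering mulmxBr mulmx1 mulmxA.
  set B := _ *m _ *m _; apply/matrixP => i j.
  rewrite !mxE /horner_eval !hornerE.
  by rewrite hornerMn hornerX mulrnBl opprB addrA addrAC.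
rewrite det_mulmx det_diag det_add1_mulC det_mx11.
have -> : (1%:M + (\row__ n%:R^-1) *m (\col_j ((x - z j)^-1 * z j))) 0 0
   = 1 + \sum_j n%:R^-1 * ((x - z j)^-1 * z j).
  by rewrite !mxE; congr (_ + _); apply: eq_bigr => j _; rewrite !mxE.
rewrite (eq_bigr (fun j => x - z j)) => [|j _]; last by rewrite mxE.
rewrite mulrCA [x * _]mulrCA; apply/eqP; congr (_ * _).
rewrite -mulr_sumr mulrDr mulr1 mulVKf // mulr_sumr.
rewrite -[X in X%:R]card_ord -sumr_const -big_split /=; apply: eq_bigr => j _.
by field.
Qed.

Lemma gram_differentiatorE n (z : 'I_n -> C) (A := differentiator z) :
  A^t* *m A = centering n *m (diag_mx (\row_j (z j)^*) *m centering n
      *m diag_mx (\row_j z j)) *m centering n.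
Proof.
rewrite /A differentiator_adj /differentiator !mulmxA.
by rewrite -[_ *m centering n *m centering n]mulmxA centering_idem.
Qed.

Lemma compressed_diagE n (z : 'I_n -> C) :
  diag_mx (\row_j (z j)^*) *m centering n *m diag_mx (\row_j z j)
  = diag_mx (\row_j `|z j| ^+ 2) - (\col_j (z j)^*) *m (\row_j (n%:R^-1 * z j)).
Proof.
rewrite /centering mulmxBr mulmx1 mulmxBl mulmx_diag; congr (_ - _).
  by congr diag_mx; apply/rowP => j; rewrite !mxE normCKC.
rewrite mulmxA -mulmxA mul_diag_col mul_row_diag; congr (_ *m _).
by apply/colP => j; rewrite !mxE mulr1.
Qed.

Lemma centering_col n (f : 'I_n -> C) :
  \sum_j f j = 0 -> centering n *m (\col_j f j) = \col_j f j.
Proof.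
move=> f0; rewrite mulmxBl mul1mx -mulmxA [X in _ *m X]mx11_scalar -trace_mx11.
by rewrite mxtrace_row_col -mulr_sumr f0 mulr0 raddf0 mulmx0 subr0.
Qed.

Lemma centering_row n (f : 'I_n -> C) :
  \sum_j f j = 0 -> (\row_j f j) *m centering n = \row_j f j.
Proof.
move=> f0; rewrite mulmxBr mulmx1 mulmxA [X in X *m _]mx11_scalar -trace_mx11.
by rewrite mxtrace_row_col -mulr_suml f0 mul0r raddf0 mul0mx subr0.
Qed.

(** With N = D^* D and K = N - a b, where a is the conjugate of the vector of
    zeros and b = z^T/n, the trace of (P K P)^3 is that of (P K)^3, and
    P K = K - c (r K) with c = 1 and r = 1^T/n.  The rank one expansion is applied
    first to P K and then to K.  Since b c = r a = 0, only moments of the |z_j|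
    and the product of r N a and b N c, conjugate to each other, survive. *)
Lemma trace_gram_differentiator_cube n (z : 'I_n -> C)
    (M := (differentiator z)^t* *m differentiator z) :
  (0 < n)%N -> \sum_(j < n) z j = 0 ->
  \tr (M *m M *m M) =
    (n%:R - 6) / n%:R * \sum_(j < n) `|z j| ^+ 6
    + 6 / n%:R ^+ 2 * (\sum_(j < n) `|z j| ^+ 4) * (\sum_(j < n) `|z j| ^+ 2)
    + 3 / n%:R ^+ 2 * `|\sum_(j < n) z j * `|z j| ^+ 2| ^+ 2
    - 2 / n%:R ^+ 3 * (\sum_(j < n) `|z j| ^+ 2) ^+ 3.
Proof.
move=> n0 hz; have nn0 : n%:R != 0 :> C by rewrite pnatr_eq0 -lt0n.
rewrite /M gram_differentiatorE compressed_diagE.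
set P := centering n; set N := diag_mx _; set a := \col_j _; set b := \row_j _.
pose c : 'cV[C]_n := \col__ 1; pose r : 'rV[C]_n := \row__ n%:R^-1.
have sc (u v : 'M[C]_1) : \tr (u *m v) = \tr u * \tr v.
  by rewrite [u]mx11_scalar [v]mx11_scalar -scalar_mxM !mxtrace_scalar.
have bc : b *m c = 0.
  rewrite [LHS]mx11_scalar -trace_mx11 mxtrace_row_col.
  rewrite (eq_bigr (fun j => n%:R^-1 * z j)) => [|j _]; last by rewrite mulr1.
  by rewrite -mulr_sumr hz mulr0 raddf0.
have ra : r *m a = 0.
  rewrite [LHS]mx11_scalar -trace_mx11 mxtrace_row_col -mulr_sumr -rmorph_sum hz.
  by rewrite rmorph0 mulr0 raddf0.
set K := N - a *m b.
have Kc : K *m c = N *m c by rewrite mulmxBl -mulmxA bc mulmx0 subr0.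
have rK : r *m K = r *m N by rewrite mulmxBr mulmxA ra mul0mx subr0.
have PP : P *m P = P by exact: centering_idem.
have -> : \tr (P *m K *m P *m (P *m K *m P) *m (P *m K *m P))
    = \tr ((K - c *m (r *m K)) *m (K - c *m (r *m K)) *m (K - c *m (r *m K))).
  have <- : P *m K = K - c *m (r *m K) by rewrite mulmxBl mul1mx mulmxA.
  rewrite !mulmxA -[_ *m P *m P]mulmxA PP -[_ *m P *m P]mulmxA PP.
  by rewrite mxtrace_mulC !mulmxA PP.
rewrite !mxtrace_cube_sub_rank1.
pose S k := \sum_j `|z j| ^+ k.
pose T := \sum_j z j * `|z j| ^+ 2.
have norm4 j : `|z j| ^+ 4 = (`|z j| ^+ 2) ^+ 2 by rewrite -exprM.
have norm6 j : `|z j| ^+ 6 = (`|z j| ^+ 2) ^+ 3 by rewrite -exprM.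
have mom (f g : 'I_n -> C) h : (forall j, f j * g j = n%:R^-1 * h j) ->
   \tr ((\row_j f j) *m (\col_j g j)) = n%:R^-1 * \sum_j h j.
  by move=> e; rewrite mxtrace_row_col mulr_sumr; apply: eq_bigr => j _.
have rNc : \tr (r *m N *m c) = n%:R^-1 * S 2.
  by rewrite mul_row_diag; apply: mom => j; rewrite mulr1.
have rNNc : \tr (r *m N *m N *m c) = n%:R^-1 * S 4.
  by rewrite !mul_row_diag; apply: mom => j; rewrite mulr1 norm4; ring.
have rNNNc : \tr (r *m N *m N *m N *m c) = n%:R^-1 * S 6.
  by rewrite !mul_row_diag; apply: mom => j; rewrite mulr1 norm6; ring.
have rNa : \tr (r *m N *m a) = n%:R^-1 * T^*.
  rewrite !mul_row_diag rmorph_sum; apply: mom => j.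
  by rewrite rmorphM /= rmorphXn /= conj_normC; ring.
have bNc : \tr (b *m N *m c) = n%:R^-1 * T.
  by rewrite !mul_row_diag; apply: mom => j; rewrite mulr1; ring.
have ba : \tr (b *m a) = n%:R^-1 * S 2.
  by apply: mom => j; rewrite normCK; ring.
have bNa : \tr (b *m N *m a) = n%:R^-1 * S 4.
  by rewrite !mul_row_diag; apply: mom => j; rewrite norm4 normCK; ring.
have bNNa : \tr (b *m (N *m N) *m a) = n%:R^-1 * S 6.
  by rewrite mulmxA !mul_row_diag; apply: mom => j; rewrite norm6 normCK; ring.
have NNN : \tr (N *m N *m N) = S 6.
  rewrite !mulmx_diag mxtrace_diag; apply: eq_bigr => j _.
  by rewrite !mxE norm6; ring.
have rKc : \tr (r *m K *m c) = n%:R^-1 * S 2 by rewrite rK.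
have rKKc : \tr (r *m K *m K *m c) = n%:R^-1 * S 4.
  by rewrite rK -mulmxA Kc mulmxA.
have rKKKc : \tr (r *m K *m (K *m K) *m c) = n%:R^-1 * S 6 - n%:R^-1 ^+ 2 * `|T| ^+ 2.
  rewrite rK -!mulmxA Kc mulmxA mulmxBl mulmxBr linearB /= !mulmxA rNNNc.
  rewrite -[_ *m b *m N *m c]mulmxA -[_ *m b *m _]mulmxA sc rNa.
  by rewrite mulmxA bNc normCK; ring.
rewrite rKc rKKc rKKKc NNN bNNa ba bNa -/(S 6) -/(S 4) -/(S 2) -/T.
by field.
Qed.

(** As conj(z) and z are orthogonal to 1, A^* A = P N P - conj(z) z^T/n, and
    A A^* is the same with the zeros conjugated; N is unaffected by that. *)
Lemma differentiator_normalP n (z : 'I_n -> C) :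
  (0 < n)%N -> \sum_(j < n) z j = 0 ->
  reflect (forall i j, z i * (z j)^* = (z i)^* * z j)
          (differentiator z \is normalmx).
Proof.
move=> n0 hz; have nn0 : n%:R != 0 :> C by rewrite pnatr_eq0 -lt0n.
have gramE (y : 'I_n -> C) : \sum_j y j = 0 ->
  (differentiator y)^t* *m differentiator y =
   centering n *m diag_mx (\row_j `|y j| ^+ 2) *m centering n
   - (\col_j (y j)^*) *m (\row_j (n%:R^-1 * y j)).
  move=> hy; rewrite gram_differentiatorE compressed_diagE.
  rewrite (mulmxBr (centering n)) (mulmxBl _ _ (centering n)).
  congr (_ - _); rewrite mulmxA centering_col; last by rewrite -rmorph_sum hy rmorph0.
  by rewrite -mulmxA centering_row // -mulr_sumr hy mulr0.
have := gramE _ hz.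
have hz' : \sum_j (z j)^* = 0 by rewrite -rmorph_sum hz rmorph0.
have := gramE _ hz'; rewrite -differentiator_adj trmxCK => e1 e2.
have ent y : ((\col_j (y j)^*) *m (\row_j (n%:R^-1 * y j))) = 
  n%:R^-1 *: \matrix_(i < n, j < n) ((y i)^* * y j) :> 'M[C]_n.
  by apply/matrixP => i j; rewrite !mxE big_ord1 !mxE mulrCA.
apply: (iffP normalmxP); rewrite e1 e2.
  have -> : \row_j `|(z j)^*| ^+ 2 = \row_j `|z j| ^+ 2 :> 'rV[C]_n.
    by apply/rowP => j; rewrite !mxE norm_conjC.
  move/addrI/oppr_inj; rewrite !ent => /(scalerI (_ : _ != 0)).
  rewrite invr_eq0 => /(_ nn0)/matrixP e i j.
  by have := e i j; rewrite !mxE conjCK.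
move=> e; congr (_ - _).
  congr (_ *m _ *m _); congr diag_mx.
  by apply/rowP => j; rewrite !mxE norm_conjC.
by rewrite !ent; congr (_ *: _); apply/matrixP => i j; rewrite !mxE conjCK e.
Qed.
End Differentiator.

(** * Collinear zeros *)

(** A line a + R b that contains all z_j contains their mean 0, so it is R b
    and the products z_i conj(z_j) are real.  Conversely, if some z_k is nonzero,
    all ratios z_j / z_k are real and the line R z_k does. *)
Lemma on_straight_line_sum0P (R : realType) (n : nat) (z : 'I_n -> R[i]) :
  (0 < n)%N -> \sum_(j < n) z j = 0 ->
  on_straight_line z <-> (forall i j, z i * (z j)^* = (z i)^* * z j).
Proof.
move=> n0 hz; have nn0 : n%:R != 0 :> R[i] by rewrite pnatr_eq0 -lt0n.
have real_conj (t : R) : (t%:C%C : R[i])^* = t%:C%C.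
  by apply/CrealP; rewrite complex_real.
split=> [[a [b [b0 /fin_all_exists [t zE]]]] i j|h].
  pose s j := t j - n%:R^-1 * \sum_k t k.
  have zs k : z k = (s k)%:C%C * b.
    have aE : n%:R * a = - (\sum_k t k)%:C%C * b.
      move: hz; rewrite (eq_bigr _ (fun k _ => zE k)) big_split /= sumr_const card_ord.
      rewrite -mulr_suml -rmorph_sum => /eqP.
      by rewrite addr_eq0 mulr_natl mulNr => /eqP.
    rewrite zE /s rmorphB rmorphM fmorphV rmorph_nat /=.
    by apply: (mulfI nn0); rewrite mulrDr aE; field.
  by rewrite !zs !rmorphM /= !real_conj; ring.
have [z0|] := altP (@forallP _ (fun j => z j == 0)).
  exists 0, 1; split; first exact: oner_neq0.
  by move=> j; exists 0; rewrite (eqP (z0 j)) rmorph0 mul0r addr0.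
rewrite negb_forall => /existsP [k zk]; exists 0, (z k); split=> // j.
have /complex_realP [t ht] : z j / z k \is Num.real.
  apply/CrealP; rewrite fmorph_div; apply/eqP.
  by rewrite eqr_div ?conjC_eq0 // -h.
by exists t; rewrite -ht add0r divfK.
Qed.

Theorem theorem2p4 (R : realType) (n : nat) (hn : (2 <= n)%N)
    (p : {poly R[i]}) (z : 'I_n -> R[i]) (w : 'I_n.-1 -> R[i])
    (hp : p = \prod_(j < n) ('X - (z j)%:P))
    (hw : lists_critical_points p w)
    (hz : \sum_(j < n) z j = 0) :
  let lhs := \sum_(k < n.-1) `|w k| ^+ 6 in
  let rhs :=
    (n%:R - 6) / n%:R * \sum_(j < n) `|z j| ^+ 6
    + 6 / n%:R ^+ 2 * (\sum_(j < n) `|z j| ^+ 4) * (\sum_(j < n) `|z j| ^+ 2)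
    + 3 / n%:R ^+ 2 * `|\sum_(j < n) z j * `|z j| ^+ 2| ^+ 2
    - 2 / n%:R ^+ 3 * (\sum_(j < n) `|z j| ^+ 2) ^+ 3 in
  lhs <= rhs /\ (lhs = rhs <-> on_straight_line z).
Proof.
move=> lhs rhs.
have n0 : (0 < n)%N by exact: ltnW.
have nn0 : n%:R != 0 :> R[i] by rewrite pnatr_eq0 -lt0n.
pose s : seq R[i] := 0 :: [seq w k | k <- index_enum 'I_n.-1].
have lhsE : lhs = \sum_(x <- s) `|x| ^+ 6.
  by rewrite big_cons normr0 expr0n add0r big_map.
have cpE : char_poly (differentiator z) = \prod_(x <- s) ('X - x%:P).
  have q_monic : \prod_(x <- s) ('X - x%:P) \is monic by exact: monic_prod_XsubC.
  have eq1 : n%:R *: char_poly (differentiator z)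
      = lead_coef p^`() *: \prod_(x <- s) ('X - x%:P).
    rewrite char_poly_differentiator // -hp [in LHS]hw big_cons big_map subr0.
    by rewrite scalerAr.
  have lc : lead_coef p^`() = n%:R.
    have := congr1 lead_coef eq1; rewrite !lead_coefZ (monicP q_monic).
    by rewrite (monicP (char_poly_monic _)) !mulr1.
  by apply: (scalerI nn0); rewrite eq1 lc.
have := sum_norm6_eigen_le_trace cpE.
rewrite trace_gram_differentiator_cube // -lhsE -/rhs => -[le_lr eq_lr].
split=> //; split=> [/eqP|].
  rewrite eq_lr => /(differentiator_normalP n0 hz).
  by move/(on_straight_line_sum0P n0 hz).
move/(on_straight_line_sum0P n0 hz)/(differentiator_normalP n0 hz).
by rewrite -eq_lr => /eqP.
Qed.
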